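(* There exist a filtered probability space $(\Omega, \mathcal{F}, \mathbb{F}, \mathbf{P})$ with filtration $\mathbb{F} = (\mathcal{F}_t)_{t \in [0,\infty)}$ and a right-continuous martingale $X = (X_t)_{t\in[0,\infty)}$ on it such that $X_\tau \in L^1$ and $\mathbb{E}[X_\tau] = \mathbb{E}[X_0]$ for all finite stopping times $\tau$, and the limit $X_\infty = \lim_{t \uparrow \infty} X_t$ exists, but $X$ is not uniformly integrable.
   Context: Martingales and stopping times are with respect to $\mathbb{F}$, and $\bigvee_{t \in [0,\infty)} \mathcal{F}_t \subset \mathcal{F}$; the filtration is not required to be right-continuous or complete. $\mathbb{E}$ is expectation under $\mathbf{P}$; $Z \in L^1$ means $\mathbb{E}[|Z|] < \infty$. All identifications and statements are understood in the almost-sure sense; in particular, a finite stopping time is one with $\tau < \infty$ almost surely. *)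

(* Defs.v *)
From mathcomp Require Import all_boot all_order all_algebra.
From mathcomp Require Import all_classical all_reals all_analysis.
Set Implicit Arguments.
Unset Strict Implicit.
Unset Printing Implicit Defensive.
Import Order.TTheory GRing.Theory Num.Theory.
Import numFieldNormedType.Exports.
Local Open Scope classical_set_scope.
Local Open Scope ring_scope.

(* The time set [0, oo) is represented by R restricted to nonnegative t: the
   values of a filtration or of a process at negative times are irrelevant and
   no definition below constrains them. *)

(* Neither right-continuity nor completeness is required. *)
Definition filtration (d : measure_display) (T : measurableType d)
    (R : realType) (F : R -> set (set T)) : Prop :=
  [/\ forall t, 0 <= t -> sigma_algebra [set: T] (F t),
      forall t, 0 <= t -> F t `<=` (@measurable d T)
    & forall s t, 0 <= s -> s <= t -> F s `<=` F t].

Definition sub_measurable (T : Type) (R : realType) (G : set (set T))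
    (Y : T -> R) : Prop :=
  forall B : set R, measurable B -> G (Y @^-1` B).

(* Z is a version of the conditional expectation E[Y | G] *)
Definition is_cond_expectation (d : measure_display) (T : measurableType d)
    (R : realType) (P : probability T R) (G : set (set T)) (Y Z : T -> R)
    : Prop :=
  [/\ sub_measurable G Z,
      P.-integrable [set: T] (EFin \o Z)
    & forall A : set T, G A ->
        (\int[P]_(w in A) (Z w)%:E = \int[P]_(w in A) (Y w)%:E)%E].

Definition martingale (d : measure_display) (T : measurableType d)
    (R : realType) (P : probability T R) (F : R -> set (set T))
    (X : R -> T -> R) : Prop :=
  [/\ forall t, 0 <= t -> sub_measurable (F t) (X t),
      forall t, 0 <= t -> P.-integrable [set: T] (EFin \o X t)
    & forall s t, 0 <= s -> s <= t -> is_cond_expectation P (F s) (X t) (X s)].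

Definition right_continuous_paths (d : measure_display) (T : measurableType d)
    (R : realType) (P : probability T R) (X : R -> T -> R) : Prop :=
  {ae P, forall w, forall t, 0 <= t -> X s w @[s --> t^'+] --> X t w}.

(* Stopping times are valued in [0, +oo]. *)
Definition stopping_time (T : Type) (R : realType) (F : R -> set (set T))
    (tau : T -> \bar R) : Prop :=
  (forall w, (0 <= tau w)%E) /\
  (forall t : R, 0 <= t -> F t [set w | (tau w <= t%:E)%E]).

Definition finite_stopping_time (d : measure_display) (T : measurableType d)
    (R : realType) (P : probability T R) (F : R -> set (set T))
    (tau : T -> \bar R) : Prop :=
  stopping_time F tau /\ {ae P, forall w, (tau w < +oo)%E}.

(* X_tau, with the dummy value 0 where tau is infinite (a null set for the
   finite stopping times) *)
Definition stopped_value (T : Type) (R : realType) (X : R -> T -> R)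
    (tau : T -> \bar R) (w : T) : R :=
  if tau w is t%:E then X t w else 0.

Definition uniformly_integrable (d : measure_display) (T : measurableType d)
    (R : realType) (P : probability T R) (I : Type) (D : set I)
    (Y : I -> T -> R) : Prop :=
  (fun K : R => ereal_sup
     [set \int[P]_(w in [set w | (K < `|Y i w|)%R]) `|Y i w|%:E | i in D])%E
    @ +oo --> 0%E.

(* Main.v *)
Require Import Defs.
From mathcomp Require Import all_boot all_order all_algebra.
From mathcomp Require Import all_classical all_reals all_analysis.
From mathcomp Require Import measurable_realfun.
Set Implicit Arguments.
Unset Strict Implicit.
Unset Printing Implicit Defensive.
Import Order.TTheory GRing.Theory Num.Theory.
Import numFieldNormedType.Exports.
Local Open Scope classical_set_scope.
Local Open Scope ring_scope.

(** Let the sample space be the natural numbers with a probability giving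
    positive mass to every point. An outcome [w > 0] is disclosed at time [w];
    before that, and forever if the outcome is [0], all one knows is that
    nothing has been disclosed. Thus at time [n] the information is the value
    of [settle n], where [0] stands for the atom of undisclosed outcomes.

    These atoms decrease to [{0}], which is not null. So a finite stopping time
    [tau] is finite at [0], and when it stops there, at time [s], it stops on
    the whole undisclosed atom; before [s] it can only stop outcomes that have
    already been disclosed, and there the martingale no longer moves.
    Therefore [X_tau] is everywhere equal to [X_s] for the deterministic time
    [s = tau 0] ([stopped_value_process]), and optional stopping reduces to
    the constancy of the expectation.

    This puts no bound on the martingale, which is fixed by the amounts
    [weight n i] that the atom of label [i] contributes to the expectation at
    time [n]. The undisclosed atom contributes [alt n = (-1)^n / (n + 1)], and
    the point [i + 1] the difference [alt i - alt (i + 1)], so the total is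
    always [alt 0 = 1] ([sum_weight]). Since [alt n] tends to [0] and [P {0}]
    is positive, the value on the undisclosed atom tends to [0] and [X]
    converges everywhere ([cvg_process]). But [alt] has infinite variation, so
    [E |X_n|] dominates the partial sums of the harmonic series
    ([integral_normr_mart_ge]), whereas uniform integrability would bound it
    ([uniformly_integrable_bounded]). *)

(** * Functions of the information available at a given time *)

Definition settle (n w : nat) : nat := if (w <= n)%N then w else 0%N.

Lemma settle_le n w : (settle n w <= n)%N.
Proof. by rewrite /settle; case: ifP. Qed.

Lemma fine_mass_gt0 (R : realType) (P : probability nat R)
    (P_gt0 : forall k, (0 < P [set k])%E) (A : set nat) (w : nat) :
  A w -> 0 < fine (P A).
Proof.
move=> Aw; apply: fine_gt0; apply/andP; split; last first.
  by rewrite ltey_eq fin_num_measure.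
apply: (lt_le_trans (P_gt0 w)); apply: le_measure; rewrite ?inE//.
by move=> _ ->.
Qed.

(** Reduces every integral of a function of [settle n] to a finite sum over
    the atoms. *)
Lemma settle_decomp (R : realType) (h : nat -> R) (n w : nat) :
  h (settle n w) =
  \sum_(i < n.+1) h i * \1_[set v | settle n v = i] w.
Proof.
rewrite (bigD1 (Ordinal (settle_le n w : (settle n w < n.+1)%N)))//=.
rewrite indicE mem_set//= mulr1 big1 ?addr0// => i /eqP ni.
rewrite indicE memNset ?mulr0//= => wi; apply: ni.
by apply/val_inj; rewrite /= wi.
Qed.

Lemma integrable_settle (R : realType) (P : probability nat R)
    (h : nat -> R) (n : nat) :
  P.-integrable [set: nat] (EFin \o (h \o settle n)).
Proof.
apply: (eq_integrable _ (fun w =>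
    (\sum_(i < n.+1) (h i)%:E * (\1_[set v | settle n v = i] w)%:E)%E)) => //.
  by move=> w _ /=; rewrite settle_decomp -sumEFin.
apply: integrable_sum => // i _; apply: integrableZl => //.
exact: integrable_indic.
Qed.

Lemma integral_settle (R : realType) (P : probability nat R)
    (h : nat -> R) (n : nat) :
  (\int[P]_w (h (settle n w))%:E =
   (\sum_(i < n.+1) h i * fine (P [set w | settle n w = i]))%:E)%E.
Proof.
under eq_integral do rewrite settle_decomp -sumEFin.
rewrite integral_sum//=; last first.
  move=> i; under eq_fun do rewrite EFinM.
  by apply: integrableZl => //; exact: integrable_indic.
rewrite -sumEFin; apply: eq_bigr => i _.
under eq_integral do rewrite EFinM.
rewrite integralZl//; last exact: integrable_indic.
by rewrite integral_indic// setIT EFinM fineK// fin_num_measure.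
Qed.

(** * The martingale in discrete time *)

Definition alt (R : realType) (n : nat) : R := (-1) ^+ n * harmonic n.

(** The contribution to the expectation at time [n] of the atom where
    [settle n] is [i]. For [i > 0] it does not depend on [n], which freezes the
    martingale on disclosed outcomes. *)
Definition weight (R : realType) (n i : nat) : R :=
  if i is k.+1 then alt R k - alt R k.+1 else alt R n.

Lemma sum_weight (R : realType) (n : nat) :
  \sum_(i < n.+1) weight R n i = 1.
Proof.
rewrite big_ord_recl/=.
rewrite (eq_bigr (fun i : 'I_n => - (alt R i.+1 - alt R i))); last first.
  by move=> i _; rewrite opprB.
rewrite sumrN -(big_mkord xpredT (fun i => alt R i.+1 - alt R i)).
rewrite telescope_sumr// opprB addrC subrK /alt expr0 mul1r.
by rewrite /harmonic /= invr1.
Qed.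

(** Consecutive values of [alt] have opposite signs, so their distance is the
    sum of their absolute values. *)
Lemma normr_weight_ge (R : realType) (n i : nat) :
  harmonic i <= `|weight R n i.+1|.
Proof.
rewrite /weight /alt exprS mulN1r mulNr opprK -mulrDr normrM normrX normrN1.
rewrite expr1n mul1r ger0_norm ?addr_ge0 ?harmonic_ge0//.
by rewrite lerDl harmonic_ge0.
Qed.

(** The atoms of [settle n], written so that the ones of positive label are
    singletons for all [n]: this makes [level] independent of [n] there. *)
Definition cell (n i : nat) : set nat :=
  if i is 0 then [set w | settle n w = 0%N] else [set i].

Lemma settle_cell (n i : nat) : (i <= n)%N ->
  [set w | settle n w = i] = cell n i.
Proof.
case: i => [//|i] lein; apply/seteqP; split => w /=; rewrite /settle.
  by case: ifP.
by move=> ->; rewrite lein.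
Qed.

Definition level (R : realType) (P : probability nat R) (n i : nat) : R :=
  weight R n i / fine (P (cell n i)).

Definition mart (R : realType) (P : probability nat R) (n w : nat) : R :=
  level P n (settle n w).

Lemma mart_settled (R : realType) (P : probability nat R) (m n w : nat) :
  (0 < w)%N -> (w <= m)%N -> (w <= n)%N -> mart P m w = mart P n w.
Proof. by case: w => // w _ wm wn; rewrite /mart /settle wm wn. Qed.

Lemma mart_unsettled (R : realType) (P : probability nat R) (n w : nat) :
  (n < w)%N -> mart P n w = mart P n 0.
Proof. by move=> nw; rewrite /mart /settle leqNgt nw. Qed.

Lemma level_mass (R : realType) (P : probability nat R)
    (P_gt0 : forall k, (0 < P [set k])%E) (n i : nat) : (i <= n)%N ->
  level P n i * fine (P [set w | settle n w = i]) = weight R n i.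
Proof.
move=> lein; rewrite settle_cell// /level mulfVK// gt_eqF//.
by apply: (@fine_mass_gt0 _ _ P_gt0 _ i); rewrite -settle_cell//= /settle lein.
Qed.

Lemma integrable_mart (R : realType) (P : probability nat R) (n : nat) :
  P.-integrable [set: nat] (EFin \o mart P n).
Proof. exact: (integrable_settle P (level P n) n). Qed.

Lemma integral_mart (R : realType) (P : probability nat R)
    (P_gt0 : forall k, (0 < P [set k])%E) (n : nat) :
  (\int[P]_w (mart P n w)%:E = 1)%E.
Proof.
rewrite integral_settle -(sum_weight R n); congr EFin.
by apply: eq_bigr => i _; rewrite level_mass// -ltnS.
Qed.

Lemma integral_normr_mart_ge (R : realType) (P : probability nat R)
    (P_gt0 : forall k, (0 < P [set k])%E) (n : nat) :
  ((series (@harmonic R) n)%:E <= \int[P]_w `|mart P n w|%:E)%E.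
Proof.
rewrite (integral_settle P (fun i => `|level P n i|)) lee_fin.
have -> : \sum_(i < n.+1) `|level P n i| * fine (P [set w | settle n w = i]) =
    \sum_(i < n.+1) `|weight R n i|.
  apply: eq_bigr => i _; rewrite -(level_mass P_gt0 (leq_ord i)) [RHS]normrM.
  by congr (_ * _); rewrite ger0_norm// fine_ge0.
rewrite big_ord_recl/= /series/= big_mkord -[leLHS]add0r lerD//.
by apply: ler_sum => i _; exact: normr_weight_ge.
Qed.

(** * The filtration generated by disclosure *)

(** The sigma-algebra of [settle n], described by its largest atom
    [{0, n + 1, n + 2, ...}]: an event cannot separate an undisclosed outcome
    from [0]. *)
Definition observable (n : nat) : set (set nat) :=
  [set A | forall w, (n < w)%N -> A w <-> A 0%N].

Lemma sigma_algebra_observable (n : nat) :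
  sigma_algebra [set: nat] (observable n).
Proof.
split.
- by move=> w _; split.
- move=> A obsA w nw; split => -[_ Aw]; split => // A0; apply: Aw;
    exact/(obsA _ nw).
- move=> A obsA w nw; split => -[k _ Akw]; exists k => //;
    exact/(obsA _ _ nw).
Qed.

Lemma observable_le (m n : nat) : (m <= n)%N -> observable m `<=` observable n.
Proof. by move=> mn A obsA w nw; apply: obsA; exact: leq_ltn_trans nw. Qed.

(** An event of time [m] that misses [0] consists of disclosed outcomes, where
    the martingale is constant from [m] on. Otherwise its complement misses
    [0], and the total expectations agree. *)
Lemma integral_mart_observable (R : realType) (P : probability nat R)
    (P_gt0 : forall k, (0 < P [set k])%E) (m n : nat) (A : set nat) :
  (m <= n)%N -> observable m A ->
  (\int[P]_(w in A) (mart P m w)%:E = \int[P]_(w in A) (mart P n w)%:E)%E.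
Proof.
move=> mn.
(* [early] is the case of an event that misses the undisclosed atom. *)
have early B : observable m B -> ~ B 0%N ->
    (\int[P]_(w in B) (mart P m w)%:E = \int[P]_(w in B) (mart P n w)%:E)%E.
  move=> obsB B0; apply: eq_integral => w; rewrite inE => Bw.
  have wm : (w <= m)%N by rewrite leqNgt; apply/negP => /obsB/iffLR/(_ Bw).
  have w0 : (0 < w)%N by case: w Bw {wm}.
  by congr EFin; apply: mart_settled => //; exact: leq_trans mn.
move=> obsA; have [A0|] := pselect (A 0%N); last exact: early.
have intC k : (\int[P]_(w in A) (mart P k w)%:E =
    1 - \int[P]_(w in ~` A) (mart P k w)%:E)%E.
  rewrite -(integral_mart P_gt0 k) -(setUv A).
  rewrite integral_setU//; last first.
    by apply/disj_setPS; rewrite setICr.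
  rewrite addeK// integrable_fin_num//.
  by apply: integrableS (integrable_mart P k) => //; exact: subsetT.
have obsC : observable m (~` A).
  by move=> w mw; split => nA Aw; apply: nA; apply/(obsA _ mw).
by rewrite !intC early// => /(_ A0).
Qed.

(** * The continuous-time process *)

Definition flow (R : realType) (t : R) : set (set nat) :=
  observable (Num.truncn t).

Definition process (R : realType) (P : probability nat R) (t : R) : nat -> R :=
  mart P (Num.truncn t).

Lemma filtration_flow (R : realType) : filtration (@flow R).
Proof.
split => [t _|t _ A _|s t _ st]; first exact: sigma_algebra_observable.
  by [].
by apply: observable_le; exact: le_truncn.
Qed.

Lemma sub_measurable_process (R : realType) (P : probability nat R) (t : R) :
  sub_measurable (flow t) (process P t).
Proof. by move=> B _ w tw; rewrite /preimage /= /process mart_unsettled. Qed.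

Lemma martingale_process (R : realType) (P : probability nat R)
    (P_gt0 : forall k, (0 < P [set k])%E) :
  martingale P (@flow R) (process P).
Proof.
split => [t _|t _|s t _ st].
- exact: sub_measurable_process.
- exact: integrable_mart.
- split; [exact: sub_measurable_process | exact: integrable_mart | move=> A].
  by apply: integral_mart_observable => //; exact: le_truncn.
Qed.

Lemma right_continuous_process (R : realType) (P : probability nat R) :
  right_continuous_paths P (process P).
Proof.
apply: aeW => w t t0; apply: cvg_near_cst.
have t1 : t < (Num.truncn t).+1%:R by case/andP: (truncn_itv t0).
near=> s; rewrite /process; congr (mart P _ w).
apply: truncn_def; apply/andP; split.
  apply: (@le_trans _ _ t); first by rewrite truncn_le.
  by apply/ltW; near: s; exact: nbhs_right_gt.
by near: s; exact: nbhs_right_lt.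
Unshelve. all: by end_near. Qed.

(** No point is null, so almost-sure finiteness is finiteness everywhere. *)
Lemma finite_stopping_time_fin (R : realType) (P : probability nat R)
    (P_gt0 : forall k, (0 < P [set k])%E) (tau : nat -> \bar R) (w : nat) :
  finite_stopping_time P (@flow R) tau -> exists2 r, 0 <= r & tau w = r%:E.
Proof.
move=> [[tau_ge0 _] tau_fin].
have : (tau w < +oo)%E.
  apply: contrapT => tauw; have := P_gt0 w.
  have w_null : P.-negligible [set w] by apply: negligibleS tau_fin => _ ->.
  by rewrite (measure_negligible _ w_null)// ltxx.
move: (tau_ge0 w); case: (tau w) => // r; rewrite lee_fin => r0 _.
by exists r.
Qed.

(** With [s = tau 0], an outcome [w] undisclosed at time [s] is
    indistinguishable from [0] up to [s], hence [tau w = s]. An outcome [w > 0]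
    disclosed by [s] cannot be stopped before its disclosure, since [0] would be
    stopped before [s] as well; so [tau w] and [s] both lie in the range of
    times where the process is constant at [w]. *)
Lemma stopped_value_process (R : realType) (P : probability nat R)
    (P_gt0 : forall k, (0 < P [set k])%E) (tau : nat -> \bar R) :
  finite_stopping_time P (@flow R) tau ->
  exists2 s : R, 0 <= s & stopped_value (process P) tau = process P s.
Proof.
move=> tauP; have tau_flow := tauP.1.2.
have [s s0 tau0] := finite_stopping_time_fin P_gt0 0 tauP.
exists s => //; apply/funext => w; rewrite /stopped_value.
have [r r0 tauw] := finite_stopping_time_fin P_gt0 w tauP; rewrite tauw.
(* An outcome undisclosed at time [t] is stopped by [t] exactly when [0] is. *)
have late t : 0 <= t -> (Num.truncn t < w)%N -> (r <= t <-> s <= t).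
  by move=> t0 /(tau_flow t t0); rewrite /= tauw tau0 !lee_fin.
case: (posnP w) => [w0|w_gt0].
  by move: tauw; rewrite w0 tau0 => -[->].
rewrite /process.
case: (ltnP (Num.truncn s) w) => [sw|ws].
  suff -> : r = s by [].
  have rs : r <= s by apply/(late _ s0 sw).
  apply/le_anti; rewrite rs/=.
  by apply/(late _ r0 (leq_ltn_trans (le_truncn rs) sw)).
apply: mart_settled => //; rewrite leqNgt; apply/negP => rw.
have /(late _ r0 rw) sr : r <= r by [].
by have := leq_trans ws (le_truncn sr); rewrite leqNgt rw.
Qed.

Lemma cvg_truncn (R : realType) :
  (Num.truncn t @[t --> (+oo : set_system R)]) --> \oo.
Proof.
apply/cvgnyPge => N; near=> t.
by rewrite truncn_ge_nat; near: t; exact: nbhs_pinfty_ge.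
Unshelve. all: by end_near. Qed.

(** At [0] the value is [alt n] divided by the mass of the undisclosed atom,
    which is at least [P {0}]; at the other outcomes the process is eventually
    constant. *)
Lemma cvg_process (R : realType) (P : probability nat R)
    (P_gt0 : forall k, (0 < P [set k])%E) (w : nat) :
  cvg (process P t w @[t --> +oo]).
Proof.
case: (posnP w) => [->|w0].
  have p0 : 0 < fine (P [set 0%N]) by exact: (@fine_mass_gt0 _ _ P_gt0 _ 0).
  have mart0 n : `|mart P n 0| <= harmonic n / fine (P [set 0%N]).
    rewrite /mart /settle leq0n /level normrM /weight /alt normrM normrX.
    rewrite normrN1 expr1n mul1r (ger0_norm (harmonic_ge0 n)).
    rewrite ler_wpM2l ?harmonic_ge0// ger0_norm ?invr_ge0 ?fine_ge0//.
    rewrite lef_pV2 ?posrE//; last exact: (@fine_mass_gt0 _ _ P_gt0 _ 0).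
    rewrite fine_le ?fin_num_measure// le_measure ?inE//.
    by move=> _ ->.
  have cvg_mart : mart P n 0 @[n --> \oo] --> (0 : R).
    apply: norm_cvg0; apply: (@squeeze_cvgr _ _ _ _ (cst 0)
      (fun n => harmonic n / fine (P [set 0%N]))).
    - by near=> n; rewrite /= normr_ge0 mart0.
    - exact: cvg_cst.
    - by rewrite -[X in _ --> X](mul0r (fine (P [set 0%N]))^-1);
        apply: cvgMl; exact: cvg_harmonic.
  by apply: (cvgP 0); exact: (cvg_comp _ _ (@cvg_truncn R) cvg_mart).
apply: (cvgP (mart P w w)); apply: cvg_near_cst.
near=> t; apply: mart_settled => //.
near: t; move/cvgnyPge: (@cvg_truncn R); exact.
Unshelve. all: by end_near. Qed.

(** * Failure of uniform integrability *)

(** Choose a level [K] above which the tails integrate to at most [1]; the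
    part below [K] contributes at most [K]. *)
Lemma uniformly_integrable_bounded (d : measure_display)
    (T : measurableType d) (R : realType) (P : probability T R) (I : Type)
    (D : set I) (Y : I -> T -> R) :
  (forall i, D i -> measurable_fun [set: T] (Y i)) ->
  uniformly_integrable P D Y ->
  exists C : R, forall i, D i -> (\int[P]_w `|Y i w|%:E <= C%:E)%E.
Proof.
move=> mY UI.
have le1_nbhs : nbhs (0%E : \bar R) [set y | (y <= 1)%E].
  (* A neighbourhood of a finite extended real is one of the real. *)
  change (nbhs (0 : R) [set r : R | (r%:E <= 1)%E]).
  apply/nbhs_ballP; exists 1 => //= r.
  rewrite /ball/= sub0r normrN lee_fin => /ltW; exact: le_trans (ler_norm r).
have K_ge0 : \forall K \near (+oo : set_system R), 0 <= K.
  exact: nbhs_pinfty_ge.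
have [K [K0 supK]] := filter_ex (filterI K_ge0 (UI _ le1_nbhs)).
exists (K + 1) => i Di.
have mnY : measurable_fun [set: T] (fun w => `|Y i w| : R).
  by apply: measurableT_comp => //; exact: mY.
have mEY : measurable_fun [set: T] (fun w => `|Y i w|%:E : \bar R).
  exact/measurable_EFinP.
pose B := [set w | K < `|Y i w|].
have mB : measurable B.
  by rewrite -[B]setTI; exact: (emeasurable_fun_o_infty measurableT mEY K%:E).
rewrite -(setvU B) ge0_integral_setU//; first last.
- by apply/disj_setPS; rewrite setICl.
- by rewrite setvU.
- exact: measurableC.
rewrite EFinD leeD//.
  apply: (@le_trans _ _ (\int[P]_(w in ~` B) (cst K%:E) w)%E).
    apply: ge0_le_integral => //.
    - exact: measurableC.
    - exact: measurable_funTS.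
    - by move=> w /= /negP; rewrite -leNgt lee_fin.
  rewrite integral_cst//; last exact: measurableC.
  rewrite -[leRHS]mule1 lee_wpmul2l ?lee_fin//.
  by apply: probability_le1; exact: measurableC.
apply: le_trans supK; apply: ereal_sup_ubound.
by exists i.
Qed.

Lemma not_uniformly_integrable_process (R : realType) (P : probability nat R)
    (P_gt0 : forall k, (0 < P [set k])%E) :
  ~ uniformly_integrable P [set t : R | 0 <= t] (process P).
Proof.
move=> /uniformly_integrable_bounded[//|C process_le].
have harm_le n : series (@harmonic R) n <= C.
  rewrite -lee_fin (le_trans (integral_normr_mart_ge P_gt0 n))//.
  by have := process_le n%:R (ler0n _ n); rewrite /process natrK.
apply: (@dvg_harmonic R); apply: (@nondecreasing_is_cvgn R).
  by apply: nondecreasing_series => k _ _; exact: harmonic_ge0.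
by exists C => _ [n _ <-]; exact: harm_le.
Qed.

(** * The counterexample *)

Lemma poisson_gt0 (R : realType) (k : nat) :
  (0 < poisson_prob (1 : R) 0 [set k])%E.
Proof.
rewrite /poisson_prob ltr01 esum_set1 ?lte_fin ?lee_fin ?poisson_pmf_ge0//.
by rewrite /poisson_pmf ltr01 !mulr_gt0 ?exprn_gt0 ?expR_gt0 ?invr_gt0 ?ltr0n
  ?fact_gt0.
Qed.

Theorem mainTheorem2 (R : realType) :
  exists (d : measure_display) (T : measurableType d) (P : probability T R)
         (F : R -> set (set T)) (X : R -> T -> R),
    [/\ filtration F,
        martingale P F X /\ right_continuous_paths P X,
        forall tau : T -> \bar R, finite_stopping_time P F tau ->
          P.-integrable [set: T] (EFin \o stopped_value X tau) /\
          ('E_P[stopped_value X tau] = 'E_P[X 0%R])%E,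
        {ae P, forall w, cvg (X t w @[t --> +oo])}
      & ~ uniformly_integrable P [set t : R | 0 <= t] X].
Proof.
have P_gt0 := @poisson_gt0 R.
exists default_measure_display, nat, (poisson_prob (1 : R) 0).
exists (@flow R), (process (poisson_prob (1 : R) 0)); split.
- exact: filtration_flow.
- by split; [exact: martingale_process | exact: right_continuous_process].
- move=> tau /(stopped_value_process P_gt0)[s s0 ->]; split.
    exact: integrable_mart.
  by rewrite unlock !integral_mart.
- by apply: aeW => w; exact: cvg_process.
- exact: not_uniformly_integrable_process.
Qed.
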